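(* Let $m_2<m_1$ be nonnegative integers with $m_1-m_2$ even, let $n=m_1+m_2+1$, and let $I=(a,b)$ with $0<a<b$. Let $f:[a,b]\to\mathbb{R}$ be such that $f^{(k)}(a)$ and $f^{(k)}(b)$ exist for $k=0,1,\dots,m_1$, $f\in C^{n+2}(I)$, and $f^{(n+1)}(x)\neq 0$ for all $x\in I$. Let $P,Q$ be the unique real polynomials of degree at most $n$ satisfying $$P^{(j)}(a)=f^{(j)}(a)\ (0\le j\le m_1),\qquad P^{(j)}(b)=f^{(j)}(b)\ (0\le j\le m_2),$$ $$Q^{(j)}(a)=f^{(j)}(a)\ (0\le j\le m_2),\qquad Q^{(j)}(b)=f^{(j)}(b)\ (0\le j\le m_1).$$ Then there is a unique $x_0$ with $a<x_0<b$ such that $P(x_0)=Q(x_0)$.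
   Context: Derivatives at the endpoints $a,b$ are understood as (iterated) one-sided derivatives of $f$ on $[a,b]$. *)

(* Defs.v *)
From mathcomp Require Import all_boot all_order all_algebra.
From mathcomp Require Import all_classical all_reals all_analysis.

Set Implicit Arguments.
Unset Strict Implicit.
Unset Printing Implicit Defensive.

Import Order.TTheory GRing.Theory Num.Theory.
Import numFieldNormedType.Exports.

Local Open Scope classical_set_scope.
Local Open Scope ring_scope.

Section WithinDerivatives.
Variable R : realType.
Implicit Types (A : set R) (f : R -> R) (x : R) (k : nat).

(* Derivatives of the restriction of [f] to [A]: the increment [y - x] is
   restricted to [y \in A].  For [A = `[a, b]] these are the one-sided
   derivatives at [a] and [b], the ordinary ones in between, and only the
   values of [f] on [A] are involved when [x \in A]. *)
Definition diff_quot_within A f x :=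
  (f y - f x) / (y - x) @[y --> within A x^'].

Definition derivable_within A f x : Prop := cvg (diff_quot_within A f x).

Definition derive1_within A f : R -> R := fun x => lim (diff_quot_within A f x).

Definition derive1n_within A k f : R -> R := iter k (derive1_within A) f.

(* The k-th derivative of the restriction of [f] to [A] exists at [x].  As
   usual, for k > 0 the derivative of order k - 1 has to exist at all points
   of [A] near [x], since [derive1_within] is total and takes junk values where
   the limit does not exist. *)
Fixpoint derivablen_within A k f x : Prop :=
  if k is k'.+1 then
    (\forall y \near within A (nbhs x), derivablen_within A k' f y) /\
    derivable_within A (derive1n_within A k' f) x
  else True.

(* Meant for open [A], where the two-sided derivatives are the right ones;
   continuity of the derivatives of order < k follows from derivability. *)
Definition continuously_derivable_on A k f : Prop :=
  forall x, A x ->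
    (forall j, (j < k)%N -> derivable (derive1n j f) x 1) /\
    {for x, continuous (derive1n k f)}.

End WithinDerivatives.

(* Main.v *)
(* Put D = P - Q and m = m2 + 1, so n = m1 + m, and pair polynomials of degree
   at most n by [D, K] = sum_j (-1)^j D^(n-j)(x) K^(j)(x), which is independent
   of x.  For a kernel K vanishing to order m at a and b, repeated integration
   by parts of f^(n+1) K over [a, b] gives - [D, K], because f - P and f - Q
   vanish to order m1 + 1 at a and b respectively.  Hence [D, K] has a definite
   sign whenever K has one on (a, b).
   Existence: K = (x-a)^m1 (x-b)^m and K = (x-a)^m (x-b)^m1 give the signs of
   D / ((x-a)^m (x-b)^m) at a and b, which differ since m1 - m is odd.
   Uniqueness: if D had two zeros in (a, b), applying m polar derivatives at a,
   m at b, and a last one at a would, by Rolle, give a polynomial with a zero z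
   in (a, b); its value at z is a nonzero multiple of [D, K] for
   K = (x-a)^(m+1) (x-b)^m (x-z)^(m1-m-1), whose last exponent is even. *)

Require Import Defs.
From mathcomp Require Import all_boot all_order all_algebra.
From mathcomp Require Import all_classical all_reals all_analysis.
From mathcomp Require Import ring lra zify.

Set Implicit Arguments.
Unset Strict Implicit.
Unset Printing Implicit Defensive.

Import Order.TTheory GRing.Theory Num.Theory.
Import numFieldNormedType.Exports.

Local Open Scope classical_set_scope.
Local Open Scope ring_scope.

(** * Polar derivatives and the apolarity pairing *)

Section PolynomialDerivatives.
Variable R : realType.
Implicit Types (D K L p : {poly R}) (c e x y : R).

Lemma derivn_mulXsubC p c j :
  (p * ('X - c%:P))^`(j) = p^`(j) * ('X - c%:P) + p^`(j.-1) *+ j.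
Proof.
elim: j => [|j IHj]; first by rewrite !derivn0 mulr0n addr0.
rewrite derivnS IHj derivD derivM derivXsubC mulr1 derivMn -derivnS -addrA.
by congr (_ + _); case: j {IHj} => [|j]; rewrite ?mulr0n ?addr0// -derivnS -mulrS.
Qed.

Lemma horner_derivn_mulXsubC p c j :
  (p * ('X - c%:P))^`(j).[c] = p^`(j.-1).[c] *+ j.
Proof.
rewrite derivn_mulXsubC hornerD hornerM hornerXsubC subrr mulr0 add0r.
by rewrite hornerMn.
Qed.

Lemma horner_derivn_mulXsubC_exp_lt p c k j : (j < k)%N ->
  (p * ('X - c%:P) ^+ k)^`(j).[c] = 0.
Proof.
elim: k j => [//|k IHk] j jk; rewrite exprSr mulrA horner_derivn_mulXsubC.
by case: j jk => [|j] jk; rewrite ?mulr0n//= IHk ?mul0rn.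
Qed.

Lemma horner_derivn_mulXsubC_exp p c k :
  (p * ('X - c%:P) ^+ k)^`(k).[c] = k`!%:R * p.[c].
Proof.
elim: k => [|k IHk]; first by rewrite expr0 mulr1 derivn0 fact0 mul1r.
by rewrite exprSr mulrA horner_derivn_mulXsubC /= IHk factS natrM -mulr_natl mulrA.
Qed.

Lemma mulXsubC_exp_of_derivn D c k :
  (forall j, (j < k)%N -> D^`(j).[c] = 0) -> exists p, D = p * ('X - c%:P) ^+ k.
Proof.
elim: k D => [|k IHk] D Dc; first by exists D; rewrite expr0 mulr1.
have /factor_theorem[q Dq] : root D c by rewrite /root -[D]derivn0 Dc.
have [j jk|p qp] := IHk q.
  have := Dc j.+1 jk.
  rewrite Dq horner_derivn_mulXsubC /= => /eqP.
  by rewrite mulrn_eq0 /= => /eqP.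
by exists p; rewrite Dq qp exprSr mulrA.
Qed.

(* The polar derivative at [c] of [D], taken of formal degree [N]; up to a
   factor it is the derivative of [D / ('X - c) ^+ N], so Rolle's theorem
   applies to it, and up to sign it is adjoint to multiplication by
   ['X - c] for the apolarity pairing. *)
Definition polar N c D := D *+ N - D^`() * ('X - c%:P).

Lemma derivn_polar N c D l : (polar N c D)^`(l) =
  D^`(l) *+ N - D^`(l) *+ l - D^`(l.+1) * ('X - c%:P).
Proof.
rewrite /polar derivnB derivnMn derivn_mulXsubC -derivSn opprD addrCA addrC.
congr (_ + _ - _); case: l => [|l]; first by rewrite !mulr0n.
by rewrite -derivSn.
Qed.

(** Both terms have [n.+1] times the coefficient of [D] in degree [n.+1], so these cancel. *)
Lemma size_polar n c D : (size D <= n.+2)%N -> (size (polar n.+1 c D) <= n.+1)%N.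
Proof.
move=> /leq_sizeP Dn; apply/leq_sizeP => j nj.
rewrite /polar mulrBr coefB coefMn coefB coefMX coefMC !coef_deriv.
rewrite (Dn j.+1) ?ltnS// mul0rn mul0r subr0.
case: j nj => [//|j] /=; rewrite leq_eqVlt => /predU1P[<-|nj]; first by rewrite subrr.
by rewrite Dn ?mul0rn ?subrr.
Qed.

Lemma polar_vanish_same N c D k : (forall j, (j < k)%N -> D^`(j).[c] = 0) ->
  forall j, (j < k)%N -> (polar N c D)^`(j).[c] = 0.
Proof.
move=> Dc j jk; rewrite derivn_polar.
rewrite !(hornerXsubC, hornerD, hornerN, hornerM, hornerMn).
by rewrite Dc// !mul0rn !subrr mulr0 subrr.
Qed.

(** Differentiating [D] costs one order of vanishing; at [c] itself the factor ['X - c%:P] makes up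
    for it. *)
Lemma polar_vanish_other N c e D k : (forall j, (j <= k)%N -> D^`(j).[e] = 0) ->
  forall j, (j < k)%N -> (polar N c D)^`(j).[e] = 0.
Proof.
move=> De j jk; rewrite derivn_polar !(hornerD, hornerN, hornerM, hornerMn).
by rewrite !De ?(ltnW jk)// !mul0rn mul0r !subrr.
Qed.

Lemma polar_rolle N c D x y : x < y -> (c < x) || (y < c) ->
  D.[x] = 0 -> D.[y] = 0 -> exists2 z, x < z < y & (polar N c D).[z] = 0.
Proof.
move=> xy cxy Dx Dy.
have zc z : z \in `[x, y] -> ('X - c%:P).[z] != 0.
  rewrite in_itv /= => /andP[xz zy]; rewrite hornerXsubC subr_eq0.
  by apply/eqP => zc; case/orP: cxy; lra.
have Dg z (zxy : z \in `[x, y]) := is_deriveM (is_derive_poly D z)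
  (is_deriveX N (is_deriveV (zc z zxy) (is_derive_poly ('X - c%:P) z))).
have [|||z] := Rolle xy (f := horner D * (fun z => ('X - c%:P).[z]^-1) ^+ N).
- move=> z zxy; apply: (@ex_derive _ _ _ _ _ _ _ (Dg z _)).
  exact: subset_itv_oo_cc zxy.
- apply: derivable_within_continuous => z zxy.
  exact: (@ex_derive _ _ _ _ _ _ _ (Dg z zxy)).
- by rewrite -[LHS]/(D.[x] * _) -[RHS]/(D.[y] * _) Dx Dy !mul0r.
move=> zxy dz; have zxy' := subset_itv_oo_cc zxy.
exists z; first by move: zxy; rewrite in_itv.
have := @derive_val _ _ _ _ _ _ _ dz.
rewrite (@derive_val _ _ _ _ _ _ _ (Dg z zxy')).
have := zc z zxy'.
rewrite derivXsubC hornerC /polar.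
rewrite !(hornerXsubC, hornerD, hornerN, hornerM, hornerMn) /GRing.scale /=.
rewrite exprfctE /= hornerXsubC hornerX hornerC.
set w := z - c => w0 h.
(* After division by [w ^+ N.+1] the polar derivative is minus the derivative of the quotient, which
   is zero at [z]. *)
have wN0 : w^-1 ^+ N.+1 != 0 by rewrite expf_neq0// invr_eq0.
apply: (mulIf wN0); rewrite mul0r -oppr0 -h -mulr_natr; case: (N) => [|k] /=.
  by rewrite !expr0 expr1; field.
by rewrite !exprS; set e := w^-1 ^+ k; field.
Qed.


(* For polynomials of degree at most [n] this is the classical apolarity
   pairing, which does not depend on [x].  For [F i] the [i]-th derivative of a
   function, it is the antiderivative of [F n.+1 * K] given by [n.+1]
   integrations by parts. *)
Definition apolar n (F : nat -> R -> R) K x : R :=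
  \sum_(j < n.+1) (-1) ^+ j * (F (n - j)%N x * K^`(j).[x]).

Definition poly_derivs D : nat -> R -> R := fun i => horner D^`(i).

(** The derivatives of the terms telescope: the one of index [j] is [u j - u j.+1], and [u n.+1] is
    zero because [K] has degree at most [n]. *)
Lemma is_derive_apolar n F K x :
    (forall i, (i <= n)%N -> is_derive x 1 (F i) (F i.+1 x)) ->
    (size K <= n.+1)%N ->
  is_derive x 1 (apolar n F K) (F n.+1 x * K.[x]).
Proof.
move=> dF sK.
pose u j := (-1) ^+ j * (F (n.+1 - j)%N x * K^`(j).[x]).
have dterm (j : 'I_n.+1) : is_derive x 1
    (fun y => (-1) ^+ j * (F (n - j)%N y * K^`(j).[y])) (u j - u j.+1).
  have dK : is_derive x 1 (horner K^`(j)) (K^`(j.+1)).[x].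
    by rewrite derivnS; exact: is_derive_poly.
  have := is_deriveZ ((-1) ^+ j) (is_deriveM (dF _ (leq_subr j n)) dK).
  rewrite /GRing.scale /= => h; apply: is_derive_eq h _.
  rewrite /u subSS -subSn ?(leq_ord j)// exprS; ring.
have -> : F n.+1 x * K.[x] = \sum_(j < n.+1) (u j - u j.+1).
  rewrite -(big_mkord xpredT (fun j => u j - u j.+1)) -[LHS]opprK.
  under eq_bigr do rewrite -opprB.
  rewrite sumrN telescope_sumr// /u subnn (derivn_poly0 sK) horner0 !mulr0.
  by rewrite sub0r expr0 mul1r subn0 derivn0.
have -> : apolar n F K =
    \sum_(j < n.+1) (fun y => (-1) ^+ j * (F (n - j)%N y * K^`(j).[y])).
  by apply/funext => y; rewrite fct_sumE.
exact: is_derive_sum.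
Qed.

Lemma apolar_poly_const n D K x y : (size D <= n.+1)%N -> (size K <= n.+1)%N ->
  apolar n (poly_derivs D) K x = apolar n (poly_derivs D) K y.
Proof.
move=> sD sK; apply: is_derive_0_is_cst => z.
have -> : 0 = poly_derivs D n.+1 z * K.[z].
  by rewrite /poly_derivs (derivn_poly0 sD) horner0 mul0r.
by apply: is_derive_apolar.
Qed.

(** At [c], multiplying [K] by ['X - c%:P] and taking the polar derivative of [D] produce the same
    factor [j.+1]; the index shift gives the sign. *)
Lemma apolar_polar n D K c : apolar n.+1 (poly_derivs D) (K * ('X - c%:P)) c =
  - apolar n (poly_derivs (polar n.+1 c D)) K c.
Proof.
rewrite /apolar big_ord_recl horner_derivn_mulXsubC mulr0n !mulr0 add0r -sumrN.
apply: eq_bigr => j _; rewrite lift0 subSS horner_derivn_mulXsubC /= /poly_derivs.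
rewrite derivn_polar hornerD hornerN hornerM hornerXsubC subrr mulr0 subr0.
rewrite hornerD hornerN !hornerMn -mulrnBr; last by rewrite ltnW// ltnS leq_subr.
have -> : (n.+1 - (n - j) = j.+1)%N by have := leq_ord j; lia.
by rewrite exprS -mulr_natr -[in RHS]mulr_natr; ring.
Qed.

(* Each step trades one of the zeros at [e] for keeping two zeros between [c]
   and [e]. *)
Lemma polar_iter N k c e i D : c != e -> (size D <= (k + N).+1)%N ->
    (forall j, (j < i)%N -> D^`(j).[c] = 0) ->
    (forall j, (j < k)%N -> D^`(j).[e] = 0) ->
    (exists x y : R, [/\ x < y, 0 < (x - c) * (e - x), 0 < (y - c) * (e - y),
       D.[x] = 0 & D.[y] = 0]) ->
  exists E : {poly R}, [/\ (size E <= N.+1)%N, forall j, (j < i)%N -> E^`(j).[c] = 0,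
    exists x y : R, [/\ x < y, 0 < (x - c) * (e - x), 0 < (y - c) * (e - y),
       E.[x] = 0 & E.[y] = 0] &
    forall M : {poly R}, (size M <= N.+1)%N -> exists s : nat, forall x,
      apolar (k + N) (poly_derivs D) (M * ('X - c%:P) ^+ k) x =
      (-1) ^+ s * apolar N (poly_derivs E) M x].
Proof.
move=> ce; elim: k D => [|k IHk] D sD Dc De Dxy.
  by exists D; split=> // M sM; exists 0%N => x; rewrite !expr0 mulr1 mul1r.
case: Dxy => x [y [xy cex cey Dx Dy]].
have De0 : D.[e] = 0 by rewrite -[D]derivn0 De.
have [||||E [sE Ec Exy EM]] := IHk (polar (k + N).+1 c D).
- exact: size_polar.
- exact: polar_vanish_same.
- exact: polar_vanish_other.
(* The positive products place [x] and [y] strictly between [c] and [e], in either order. Rolle is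
   applied between [x] and [y], and between [e] and the nearer of the two. *)
- have [ec|ec|] := ltgtP c e; last by move/eqP; rewrite (negPf ce).
  + have cx : c < x by nra.
    have ye : y < e by nra.
    have cy : c < y by exact: lt_trans cx xy.
    have [|z /andP[xz zy] Pz] := @polar_rolle (k + N).+1 c D x y xy _ Dx Dy.
      by rewrite cx.
    have [|w /andP[yw we] Pw] := @polar_rolle (k + N).+1 c D y e ye _ Dy De0.
      by rewrite cy.
    by exists z, w; split=> //; [lra|nra|nra].
  + have yc : y < c by nra.
    have ex : e < x by nra.
    have xc : x < c by exact: lt_trans xy yc.
    have [|z /andP[xz zy] Pz] := @polar_rolle (k + N).+1 c D x y xy _ Dx Dy.
      by rewrite yc orbT.
    have [|w /andP[ew wx] Pw] := @polar_rolle (k + N).+1 c D e x ex _ De0 Dx.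
      by rewrite xc orbT.
    by exists w, z; split=> //; [lra|nra|nra].
exists E; split=> // M sM; have [s EMs] := EM _ sM; exists s.+1 => t.
have sMX : (size (M * ('X - c%:P) ^+ k)%R <= (k + N).+1)%N.
  apply: leq_trans (size_polyMleq _ _) _; rewrite size_exp_XsubC.
  by rewrite addnS /= addnC -addnS leq_add2l.
(* [apolar_polar] is an identity at [c], so the evaluation point is moved there and back. *)
rewrite exprSr mulrA (@apolar_poly_const _ _ _ t c)//; last first.
  apply: leq_trans (size_polyMleq _ _) _; rewrite size_XsubC addnS addn1 /=.
  by rewrite addSn.
rewrite addSn apolar_polar exprS -mulrA -EMs mulN1r; congr (- _).
by apply: apolar_poly_const => //; exact: size_polar.
Qed.

(** Terms with [j < k] vanish through the kernel and terms with [j > k] through [D], which leaves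
    [j = k]. *)
Lemma apolar_mulXsubC_exp n D K k c : (k <= n)%N ->
    (forall j, (j < n - k)%N -> D^`(j).[c] = 0) ->
  apolar n (poly_derivs D) (K * ('X - c%:P) ^+ k) c =
  (-1) ^+ k * (D^`(n - k).[c] * (k`!%:R * K.[c])).
Proof.
move=> kn Dc; rewrite /apolar (bigD1 (Ordinal (kn : (k < n.+1)%N)))//= big1 ?addr0.
  by rewrite horner_derivn_mulXsubC_exp.
move=> j; rewrite -val_eqE /= neq_ltn => /orP[jk|kj].
  by rewrite horner_derivn_mulXsubC_exp_lt// !mulr0.
rewrite /poly_derivs Dc ?mul0r ?mulr0// ltn_sub2l//.
exact: leq_trans kj (leq_ord j).
Qed.

End PolynomialDerivatives.

(** * One-sided derivatives at the endpoints *)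

Section WithinInterior.
Variable R : realType.
Implicit Types (A : set R) (f g h : R -> R) (a b c e x y : R).

Lemma derivable_within_cvg A g c : derivable_within A g c ->
  g x @[x --> within A c^'] --> g c.
Proof.
have ? : Filter (within A c^') by exact: within_filter.
have neq : within A c^' (fun x => x != c).
  by apply: (filterS _ (nbhs_dnbhs_neq c)) => y yc _.
move=> /cvg_ex[l]; rewrite /diff_quot_within => gl.
have xc : x - c @[x --> within A c^'] --> (0 : R).
  apply: cvg_within_filter; rewrite /dnbhs; apply: cvg_within_filter.
  have := @cvgB R R R (nbhs c) _ id (cst c) c c (@cvg_id _ _) (@cvg_cst _ _ _ _ _).
  by rewrite subrr; exact.
have h := cvgD (cvgM gl xc) (cvg_cst (g c)).
move: h; rewrite mulr0 add0r => h.
apply: cvg_trans (h _ _ _); apply: near_eq_cvg.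
near=> x; have xc' : x != c.
  by near: x; exact: neq.
apply: (@etrans _ _ ((g x - g c) / (x - c) * (x - c) + g c)) => //.
by rewrite mulfVK ?subr_eq0// subrK.
Unshelve. all: by end_near. Qed.

(** At an interior point [within A x^'] is [x^'], and near [x] the quotient of [g] is the
    Caratheodory slope of [h], which is continuous at [x]. *)
Lemma derive1_within_near A g h x : A° x -> (\near x, g x = h x) ->
  derivable h x 1 -> derive1_within A g x = h^`()%classic x.
Proof.
move=> Ax gh dh.
have [q [hq qx q0]] : exists q : R -> R, [/\ forall z, h z - h x = q z * (z - x),
    {for x, continuous q} & q x = h^`()%classic x].
  by apply/is_derive1_caratheodory; rewrite derive1E; exact: derivableP.
have ghx := nbhs_singleton gh.
have AE : within A x^' = x^'.
  have Ax' : x^' A by apply: filterS Ax => y Ay _; exact: Ay.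
  apply/seteqP; split=> P AP; last first.
    by apply: (filterS _ (AP : x^' P)) => y.
  have AP' : x^' (fun y => A y -> P y) := AP.
  by apply: filterS (filterI AP' Ax') => y [h1 h2]; exact: h1.
rewrite /derive1_within /diff_quot_within AE; apply: cvg_lim => //.
apply: (@cvg_trans _ (q y @[y --> x^'])); last first.
  by rewrite -q0 /dnbhs; apply: cvg_within_filter.
apply: near_eq_cvg; near=> y.
have yx : y != x.
  by near: y; exact: nbhs_dnbhs_neq.
have -> : g y = h y.
  by near: y; apply: cvg_within.
by rewrite ghx hq mulfK// subr_eq0.
Unshelve. all: by end_near. Qed.

Lemma derive1n_within_interior f a b N :
    (forall x, a < x < b -> forall j, (j < N)%N -> derivable (derive1n j f) x 1) ->
  forall j, (j <= N)%N -> forall x, a < x < b ->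
  derive1n_within `[a, b] j f x = derive1n j f x.
Proof.
move=> df; elim=> [//|j IHj] jN x xab.
rewrite derive1nS /derive1n_within iterS -/(derive1n_within _ _ _).
have xo : x \in `]a, b[ by rewrite in_itv.
apply: derive1_within_near; last exact: df.
- by rewrite interior_itv; exact: xo.
- near=> y; apply: IHj; first exact: ltnW.
  by near: y; have := near_in_itvoo xo; apply: filterS => y; rewrite in_itv.
Unshelve. all: by end_near. Qed.

End WithinInterior.

(** * Interior sequences approaching an endpoint *)

Section EndpointSequences.
Variable R : realType.
Implicit Types (A : set R) (f g h : R -> R) (a b c e x y z : R).

Lemma cvg_seq_within A (z_ : nat -> R) c : (forall k, A (z_ k)) ->
  (forall k, z_ k != c) -> z_ k @[k --> \oo] --> c ->
  z_ k @[k --> \oo] --> within A c^'.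
Proof.
move=> Az zc zcvg P AP.
have cP : nbhs c (fun y => y != c -> A y -> P y) by exact: AP.
have zP : \forall k \near \oo, z_ k != c -> A (z_ k) -> P (z_ k) := zcvg _ cP.
suff : \forall k \near \oo, P (z_ k) by [].
by apply: filterS zP => k; exact.
Qed.

(** The mean value theorem between [c] and [y]; continuity at the endpoint [c] comes from
    derivability there. *)
Lemma derivable_within_mean_value f a b c y m :
    c = a \/ c = b -> a < y < b ->
    (forall x, a < x < b -> forall j, (j < m.+1)%N -> derivable (derive1n j f) x 1) ->
    derivable_within `[a, b] (derive1n_within `[a, b] m f) c ->
  exists z, [/\ a < z < b, `|z - c| <= `|y - c| &
    derive1n m.+1 f z = (derive1n_within `[a, b] m f y -
      derive1n_within `[a, b] m f c) / (y - c)].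
Proof.
move=> cab /andP[ay yb] df dc; set g := derive1n_within `[a, b] m f.
have dg x : a < x < b -> is_derive x 1 g (derive1n m.+1 f x).
  move=> xab; have xo : x \in `]a, b[ by rewrite in_itv.
  rewrite derive1nS derive1E.
  apply: (@near_eq_is_derive _ _ _ (derive1n m f)); last first.
    by apply: derivableP; exact: df.
  near=> t; apply/esym; apply: (derive1n_within_interior df) => //.
  by near: t; have := near_in_itvoo xo; apply: filterS => t; rewrite in_itv.
have gcont x : a < x < b -> {for x, continuous g}.
  move=> xab; apply: differentiable_continuous; apply/derivable1_diffP.
  exact: (@ex_derive _ _ _ _ _ _ _ (dg x xab)).
have gc := derivable_within_cvg dc.
case: cab => ?; subst c.
- have [x||z] := @MVT _ g (derive1n m.+1 f) _ _ ay.
  + by rewrite in_itv /= => /andP[ax xy]; apply: dg; rewrite ax (lt_trans xy).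
  + apply/(continuous_within_itvP _ ay); split.
    * move=> x; rewrite in_itv /= => /andP[ax xy]; apply: gcont.
      by rewrite ax (lt_trans xy).
    * apply: cvg_trans gc; apply: cvg_app => P AP.
      have aP : nbhs a (fun t => t != a -> `[a, b]%classic t -> P t) by exact: AP.
      have aP' : \forall t \near a^'+, t != a -> `[a, b]%classic t -> P t.
        by apply: (filterS _ aP) => t h _.
      near=> t; apply: (near aP' t) => //.
      rewrite /= in_itv /=; apply/andP; split; near: t.
          exact: nbhs_right_ge.
        by apply: nbhs_right_le; exact: lt_trans yb.
    * by apply: cvg_at_left_filter; apply: gcont; rewrite ay.
  rewrite in_itv /= => /andP[az zy] E; exists z; split.
  + by rewrite az (lt_trans zy).
  + by rewrite !gtr0_norm ?subr_gt0// lerD2r ltW.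
  + by rewrite E mulfK// subr_eq0 gt_eqF.
- have [x||z] := @MVT _ g (derive1n m.+1 f) _ _ yb.
  + by rewrite in_itv /= => /andP[yx xb]; apply: dg; rewrite xb (lt_trans ay).
  + apply/(continuous_within_itvP _ yb); split.
    * move=> x; rewrite in_itv /= => /andP[yx xb]; apply: gcont.
      by rewrite xb (lt_trans ay).
    * by apply: cvg_at_right_filter; apply: gcont; rewrite ay.
    * apply: cvg_trans gc; apply: cvg_app => P AP.
      have bP : nbhs b (fun t => t != b -> `[a, b]%classic t -> P t) by exact: AP.
      have bP' : \forall t \near b^'-, t != b -> `[a, b]%classic t -> P t.
        by apply: (filterS _ bP) => t h _.
      near=> t; apply: (near bP' t) => //.
      rewrite /= in_itv /=; apply/andP; split; near: t.
          by apply: nbhs_left_ge; exact: lt_trans yb.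
        exact: nbhs_left_le.
  rewrite in_itv /= => /andP[yz zb] E; exists z; split.
  + by rewrite zb (lt_trans ay).
  + by rewrite !ltr0_norm ?subr_lt0// lerN2 lerD2r ltW.
  + by rewrite -opprB E -mulrN opprB mulfK// subr_eq0 lt_eqF.
Unshelve. all: by end_near. Qed.

(* The derivative of order [m.+1] need not be assumed continuous at [c]: the
   mean value theorem provides points at which it equals difference quotients
   of the derivative of order [m]. *)
Lemma endpoint_sequence f a b c m : a < b -> c = a \/ c = b ->
    (forall x, a < x < b -> forall j, (j < m.+1)%N -> derivable (derive1n j f) x 1) ->
    (forall k, (k <= m.+1)%N -> derivablen_within `[a, b] k f c) ->
  exists z_ : nat -> R, [/\ forall k, a < z_ k < b, z_ k @[k --> \oo] --> c &
    forall i, (i <= m.+1)%N ->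
      derive1n i f (z_ k) @[k --> \oo] --> derive1n_within `[a, b] i f c].
Proof.
move=> ab cab df dc.
have dcw i : (i <= m)%N -> derivable_within `[a, b] (derive1n_within `[a, b] i f) c.
  by move=> im; have [] := dc i.+1 im.
(* [harmonic k] is [1 / (k + 1)], so [y_] runs from the midpoint towards [c] inside the interval. *)
pose y_ k := c + ((a + b) / 2 - c) * harmonic k.
have y_ab k : a < y_ k < b.
  rewrite /y_ /harmonic /=.
  have : 0 < (k.+1%:R^-1 : R) <= 1 by rewrite invr_gt0 ltr0Sn invf_le1// ler1n.
  by move: (k.+1%:R^-1) => t /andP[t0 t1]; case: cab => ->; apply/andP; split; nra.
have y_c : y_ k @[k --> \oo] --> c.
  have := cvgD (cvg_cst c) (cvgM (cvg_cst ((a + b) / 2 - c)) (@cvg_harmonic R)).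
  by rewrite mulr0 addr0; exact.
have neq_c x : a < x < b -> x != c.
  by move=> /andP[ax xb]; case: cab => ->; [rewrite gt_eqF|rewrite lt_eqF].
have within_c (x_ : nat -> R) : (forall k, a < x_ k < b) -> x_ k @[k --> \oo] --> c ->
    x_ k @[k --> \oo] --> within `[a, b] c^'.
  move=> xab; apply: cvg_seq_within => k; last exact: neq_c.
  by have /andP[/ltW ax /ltW xb] := xab k; rewrite /= in_itv /= ax.
have /choice[z_ z_P] k := derivable_within_mean_value cab (y_ab k) df (dcw m (leqnn m)).
have z_c : z_ k @[k --> \oo] --> c.
  apply/cvgrPdist_le => e e0; move/cvgrPdist_le : y_c => /(_ _ e0).
  apply: filterS => k; have [_ h _] := z_P k.
  by rewrite distrC => /(le_trans h); rewrite distrC.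
exists z_; split=> //; first by move=> k; have [] := z_P k.
have z_ab k : a < z_ k < b by have [] := z_P k.
move=> i; rewrite leq_eqVlt => /predU1P[->|im].
  rewrite (_ : (fun k => _) = fun k => (derive1n_within `[a, b] m f (y_ k) -
      derive1n_within `[a, b] m f c) / (y_ k - c)); last first.
    by apply/funext => k; have [] := z_P k.
  exact: cvg_comp (within_c _ y_ab y_c) (dcw m (leqnn m)).
rewrite (_ : (fun k => _) = derive1n_within `[a, b] i f \o z_); last first.
  apply/funext => k; apply/esym; apply: (derive1n_within_interior df) => //.
  exact: ltnW.
exact: cvg_comp (within_c _ z_ab z_c) (derivable_within_cvg (dcw i im)).
Qed.

End EndpointSequences.

(** * Sign of the pairing *)

Section SignOfPairing.
Variable R : realType.
Implicit Types (D K L p : {poly R}) (F : nat -> R -> R) (a b c u v x y : R).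

(** The evaluation point varies along with the polynomial because the kernels have moving zeros and
    are evaluated at them. *)
Definition cvg_derivs (p_ : nat -> {poly R}) (x_ : nat -> R) p c :=
  forall j, (p_ k)^`(j).[x_ k] @[k --> \oo] --> p^`(j).[c].

Lemma cvg_derivs_cst p (x_ : nat -> R) c : x_ k @[k --> \oo] --> c ->
  cvg_derivs (fun=> p) x_ p c.
Proof. by move=> xc j; apply: cvg_comp xc _; exact: continuous_horner. Qed.

Lemma cvg_derivs_mulXsubC (p_ : nat -> {poly R}) (x_ a_ : nat -> R) p c a k :
    x_ k @[k --> \oo] --> c -> a_ k @[k --> \oo] --> a -> cvg_derivs p_ x_ p c ->
  cvg_derivs (fun i => p_ i * ('X - (a_ i)%:P) ^+ k) x_ (p * ('X - a%:P) ^+ k) c.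
Proof.
move=> xc aa pc; elim: k => [|k IHk] j.
  by under eq_cvg do rewrite expr0 mulr1; rewrite expr0 mulr1; exact: pc.
rewrite exprSr mulrA derivn_mulXsubC hornerD hornerM hornerXsubC hornerMn.
under eq_cvg do
  rewrite exprSr mulrA derivn_mulXsubC hornerD hornerM hornerXsubC hornerMn.
apply: cvgD; first by apply: cvgM; [exact: IHk|exact: cvgB].
under eq_cvg do rewrite -mulr_natr.
by rewrite -mulr_natr; apply: cvgM; [exact: IHk|exact: cvg_cst].
Qed.

Lemma cvg_apolar_interior n F (p_ : nat -> {poly R}) p x :
    cvg_derivs p_ (fun=> x) p x ->
  apolar n F (p_ k) x @[k --> \oo] --> apolar n F p x.
Proof.
move=> pc; apply: cvg_big => [|j _]; first exact: add_continuous.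
apply: cvgM; first exact: cvg_cst.
by apply: cvgM; [exact: cvg_cst|exact: pc].
Qed.

(** The kernel vanishes to order [m] at [x_ k], which kills the terms [j < m]; the others involve
    only [F i] with [i <= n - m]. *)
Lemma cvg_apolar_endpoint n m F (w : nat -> R) (p_ : nat -> {poly R}) p
    (x_ : nat -> R) c :
    x_ k @[k --> \oo] --> c -> cvg_derivs p_ x_ p c ->
    (forall i, (i <= n - m)%N -> F i (x_ k) @[k --> \oo] --> w i) ->
  apolar n F (p_ k * ('X - (x_ k)%:P) ^+ m) (x_ k) @[k --> \oo] -->
  apolar n (fun i => cst (w i)) (p * ('X - c%:P) ^+ m) c.
Proof.
move=> xc pc Fw; apply: cvg_big => [|j _]; first exact: add_continuous.
apply: cvgM; first exact: cvg_cst.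
have [jm|mj] := ltnP j m.
  under eq_cvg do rewrite horner_derivn_mulXsubC_exp_lt// mulr0.
  by rewrite horner_derivn_mulXsubC_exp_lt// mulr0; exact: cvg_cst.
apply: cvgM; last exact: (@cvg_derivs_mulXsubC _ _ _ _ _ _ m xc xc pc j).
by apply: Fw; lia.
Qed.

Lemma homo_of_is_derive_ge0 (h dh : R -> R) x y : x <= y ->
    (forall z, x <= z <= y -> is_derive z 1 h (dh z)) ->
    (forall z, x <= z <= y -> 0 <= dh z) ->
  h x <= h y.
Proof.
move=> xy hd dh0.
have [z||z zxy E] := @MVT_segment _ h dh _ _ xy.
- by rewrite in_itv /= => /andP[/ltW xz /ltW zy]; apply: hd; rewrite xz.
- apply: derivable_within_continuous => z; rewrite in_itv /= => zxy.
  exact: (@ex_derive _ _ _ _ _ _ _ (hd z zxy)).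
rewrite -subr_ge0 E; apply: mulr_ge0; last by rewrite subr_ge0.
by apply: dh0; move: zxy; rewrite in_itv.
Qed.

Lemma lt_of_is_derive_gt0 (h dh : R -> R) x y : x < y ->
    (forall z, x <= z <= y -> is_derive z 1 h (dh z)) ->
    (forall z, x < z < y -> 0 < dh z) ->
  h x < h y.
Proof.
move=> xy hd dh0.
have [z||z zxy E] := @MVT _ h dh _ _ xy.
- by rewrite in_itv /= => /andP[/ltW xz /ltW zy]; apply: hd; rewrite xz.
- apply: derivable_within_continuous => z; rewrite in_itv /= => zxy.
  exact: (@ex_derive _ _ _ _ _ _ _ (hd z zxy)).
rewrite -subr_gt0 E; apply: mulr_gt0; last by rewrite subr_gt0.
by apply: dh0; move: zxy; rewrite in_itv.
Qed.

(* The derivatives [F i] with [n - m < i] may be unbounded at [a] and [b], so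
   the zeros of the kernel are moved to [a_ k] and [b_ k]; then only the [F i]
   with [i <= n - m] enter the boundary terms. *)
Lemma apolar_lt0 n m F D L (a_ b_ : nat -> R) a b u v : (m + m <= n)%N ->
    (forall x, a < x < b -> forall i, (i <= n)%N -> is_derive x 1 (F i) (F i.+1 x)) ->
    (size L <= (n - (m + m)).+1)%N ->
    (forall k, a < a_ k < b) -> a_ k @[k --> \oo] --> a ->
    (forall i, (i <= n - m)%N -> F i (a_ k) @[k --> \oo] --> 0) ->
    (forall k, a < b_ k < b) -> b_ k @[k --> \oo] --> b ->
    (forall i, (i <= n - m)%N -> F i (b_ k) @[k --> \oo] --> - D^`(i).[b]) ->
    (forall x, a < x < b -> 0 <= F n.+1 x * ((-1) ^+ m * L.[x])) ->
    a < u -> u < v -> v < b ->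
    (forall x, u < x < v -> 0 < F n.+1 x * ((-1) ^+ m * L.[x])) ->
  apolar n (poly_derivs D) (L * ('X - a%:P) ^+ m * ('X - b%:P) ^+ m) b < 0.
Proof.
move=> mn dF sL a_ab a_a Fa b_ab b_b Fb L0 au uv vb Luv.
pose Kab x y := L * ('X - x%:P) ^+ m * ('X - y%:P) ^+ m.
have sK x y : (size (Kab x y) <= n.+1)%N.
  apply: leq_trans (size_polyMleq _ _) _; rewrite size_exp_XsubC addnS /=.
  have := size_polyMleq L (('X - x%:P) ^+ m); rewrite size_exp_XsubC addnS /= => h.
  apply: leq_trans (leq_add h (leqnn m)) _.
  by rewrite -addnA addnC -leq_subRL ?subSn// leqW.
have dW x y z : a < z < b ->
    is_derive z 1 (apolar n F (Kab x y)) (F n.+1 z * (Kab x y).[z]).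
  by move=> zab; apply: is_derive_apolar (sK x y) => i; exact: dF.
(* The sign [(-1) ^+ m] is split off so that the last factor is nonnegative for [z] in [[x, y]]. *)
have KE x y z : (Kab x y).[z] =
    ((-1) ^+ m * L.[z]) * ((z - x) ^+ m * (y - z) ^+ m).
  rewrite /Kab !hornerM !horner_exp !hornerXsubC.
  have -> : z - y = -1 * (y - z) by ring.
  by rewrite exprMn; ring.
have dW0 x y z : x <= z <= y -> a < z < b -> 0 <= F n.+1 z * (Kab x y).[z].
  move=> /andP[xz zy] zab; rewrite KE mulrA mulr_ge0// ?L0// mulr_ge0//.
    by rewrite exprn_ge0// subr_ge0.
  by rewrite exprn_ge0// subr_ge0.
(* The pairing is nondecreasing on [[a_ k, b_ k]], so the boundary terms dominate its increment over
   the fixed interval [[u, v]], whose limit is positive by [Wuv]. *)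
have mono : \forall k \near \oo,
    apolar n F (Kab (a_ k) (b_ k)) v - apolar n F (Kab (a_ k) (b_ k)) u <=
    apolar n F (Kab (a_ k) (b_ k)) (b_ k) - apolar n F (Kab (a_ k) (b_ k)) (a_ k).
  near=> k.
  have aku : a_ k < u by near: k; exact: cvgr_lt a_a _ au.
  have vbk : v < b_ k by near: k; exact: cvgr_gt b_b _ vb.
  have /andP[aak akb] := a_ab k; have /andP[abk bkb] := b_ab k.
  have h1 : apolar n F (Kab (a_ k) (b_ k)) (a_ k) <= apolar n F (Kab (a_ k) (b_ k)) u.
    apply: homo_of_is_derive_ge0 (ltW aku) _ _ => z /andP[az zu].
      by apply: dW; apply/andP; split; lra.
    by apply: dW0; apply/andP; split; lra.
  have h2 : apolar n F (Kab (a_ k) (b_ k)) v <= apolar n F (Kab (a_ k) (b_ k)) (b_ k).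
    apply: homo_of_is_derive_ge0 (ltW vbk) _ _ => z /andP[az zu].
      by apply: dW; apply/andP; split; lra.
    by apply: dW0; apply/andP; split; lra.
  exact: lerB h2 h1.
have Wuv : apolar n F (Kab a b) u < apolar n F (Kab a b) v.
  apply: lt_of_is_derive_gt0 uv _ _ => z /andP[uz zv].
    by apply: dW; apply/andP; split; lra.
  rewrite /= KE mulrA mulr_gt0//; first by apply: Luv; rewrite uz.
  by rewrite mulr_gt0// exprn_gt0// subr_gt0; lra.
have cvg_in z :
    apolar n F (Kab (a_ k) (b_ k)) z @[k --> \oo] --> apolar n F (Kab a b) z.
  apply: cvg_apolar_interior.
  have zz : (fun=> z) k @[k --> \oo] --> z by exact: cvg_cst.
  apply: cvg_derivs_mulXsubC => //; apply: cvg_derivs_mulXsubC => //.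
  exact: cvg_derivs_cst.
have cvg_b : apolar n F (Kab (a_ k) (b_ k)) (b_ k) @[k --> \oo] -->
    - apolar n (poly_derivs D) (Kab a b) b.
  have -> : - apolar n (poly_derivs D) (Kab a b) b =
      apolar n (fun i => cst (- D^`(i).[b])) (Kab a b) b.
    by rewrite /apolar -sumrN; apply: eq_bigr => j _; rewrite /cst mulNr mulrN.
  apply: cvg_apolar_endpoint => //; apply: cvg_derivs_mulXsubC => //.
  exact: cvg_derivs_cst.
have cvg_a : apolar n F (Kab (a_ k) (b_ k)) (a_ k) @[k --> \oo] --> 0.
  have -> : 0 = apolar n (fun i => cst 0) (L * ('X - b%:P) ^+ m * ('X - a%:P) ^+ m) a.
    by rewrite /apolar big1// => j _; rewrite /cst mul0r mulr0.
  under eq_cvg do rewrite /Kab mulrAC.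
  apply: cvg_apolar_endpoint => //; apply: cvg_derivs_mulXsubC => //.
  exact: cvg_derivs_cst.
have h := ler_cvg_to (cvgB (cvg_in v) (cvg_in u)) (cvgB cvg_b cvg_a) mono.
rewrite subr0 in h.
by rewrite -oppr_gt0; apply: (lt_le_trans _ (h _ _ _)); rewrite subr_gt0.
Unshelve. all: by end_near. Qed.

End SignOfPairing.

(** * The crossing point *)

Section UniqueCrossing.
Variable R : realType.
Implicit Types (D L p : {poly R}) (a b u v x y s : R).

Variables (m d n : nat) (D : {poly R}) (a b s : R).
Hypotheses (d_even : ~~ odd d) (ab : a < b) (nE : n = (m + (m + d.+1))%N).
Hypothesis size_D : (size D <= n.+1)%N.
Hypothesis vanish_a : forall j, (j < m)%N -> D^`(j).[a] = 0.
Hypothesis vanish_b : forall j, (j < m)%N -> D^`(j).[b] = 0.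
Hypothesis apolar_neg : forall L, (size L <= d.+2)%N ->
  (forall x, a < x < b -> 0 <= L.[x]) ->
  (exists u v, [/\ a < u, u < v, v < b & forall x, u < x < v -> 0 < L.[x]]) ->
  apolar n (poly_derivs D) (s *: L * ('X - a%:P) ^+ m * ('X - b%:P) ^+ m) b < 0.

Let size_K L : (size L <= d.+2)%N ->
  (size (L * ('X - a%:P) ^+ m * ('X - b%:P) ^+ m)%R <= n.+1)%N.
Proof.
move=> sL; apply: leq_trans (size_polyMleq _ _) _; rewrite size_exp_XsubC addnS /=.
have := size_polyMleq L (('X - a%:P) ^+ m); rewrite size_exp_XsubC addnS /= => h.
apply: leq_trans (leq_add h (leqnn m)) _.
by rewrite -addnA addnC nE addnA -addnS leq_add2l.
Qed.

Lemma crossing_exists : exists2 x, a < x < b & D.[x] = 0.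
Proof.
have [p Dp] : exists p, D = p * ('X - a%:P) ^+ m * ('X - b%:P) ^+ m.
  have [p pa] := mulXsubC_exp_of_derivn vanish_a.
  have [q qb] := mulXsubC_exp_of_derivn vanish_b.
  have : ('X - a%:P) ^+ m * ('X - b%:P) ^+ m %| D.
    rewrite Gauss_dvdp.
      by apply/andP; split; [rewrite pa|rewrite qb]; exact: dvdp_mulIr.
    apply: coprimep_expl; apply: coprimep_expr; apply: coprimep_XsubC2.
    by rewrite subr_eq0 gt_eqF.
  by move=> /dvdpP[r ->]; exists r; rewrite mulrA.
have nm : (n - (m + d.+1) = m)%N by rewrite nE addnK.
have mn : (m + d.+1 <= n)%N by rewrite nE leq_addl.
have Dma : D^`(m).[a] = m`!%:R * (p.[a] * (a - b) ^+ m).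
  by rewrite Dp mulrAC horner_derivn_mulXsubC_exp !hornerE.
have Dmb : D^`(m).[b] = m`!%:R * (p.[b] * (b - a) ^+ m).
  by rewrite Dp horner_derivn_mulXsubC_exp !hornerE.
have fact_gt0 k : 0 < k`!%:R :> R by rewrite ltr0n fact_gt0.
(* With this common factor the two pairings become positive multiples of [t * p.[a]] and [- (t *
   p.[b])]. *)
pose t := (-1) ^+ (m + d.+1) * s.
have mid1 : a < (a + a + b) / 3 by move: ab; lra.
have mid2 : (a + a + b) / 3 < (a + b) / 2 by move: ab; lra.
have mid3 : (a + b) / 2 < b by move: ab; lra.
have size_scaled (q : {poly R}) : (size q <= d.+2)%N -> (size (s *: q) <= d.+2)%N.
  exact: leq_trans (size_scale_leq _ _).
have ta : t * p.[a] < 0.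
  have KE : s *: ('X - a%:P) ^+ d.+1 * ('X - a%:P) ^+ m * ('X - b%:P) ^+ m =
      s *: ('X - b%:P) ^+ m * ('X - a%:P) ^+ (m + d.+1).
    by rewrite exprD -!mul_polyC; ring.
  have sL : (size (('X - a%:P) ^+ d.+1)%R <= d.+2)%N by rewrite size_exp_XsubC.
  have := apolar_neg sL.
  rewrite (apolar_poly_const b a size_D (size_K (size_scaled _ sL))) KE.
  rewrite apolar_mulXsubC_exp// ?nm// Dma hornerZ horner_exp hornerXsubC.
  (* This power occurs once in the derivative of [D] and once in the kernel, so only its positive
     square enters. *)
  set e := (a - b) ^+ m => h.
  have e0 : e != 0 by rewrite expf_neq0// subr_eq0 lt_eqF.
  have e2 : 0 < e ^+ 2 by rewrite lt_neqAle sqr_ge0 eq_sym sqrf_eq0 e0.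
  rewrite -(pmulr_llt0 _ (mulr_gt0 (mulr_gt0 (fact_gt0 m) (fact_gt0 (m + d.+1)%N)) e2)).
  rewrite [X in X < 0](_ : _ = (-1) ^+ (m + d.+1) * (m`!%:R * (p.[a] * e) *
    ((m + d.+1)`!%:R * (s * e)))); last by rewrite /t; ring.
  apply: h => [x /andP[ax _]|].
    by rewrite horner_exp hornerXsubC exprn_ge0// subr_ge0 ltW.
  exists ((a + a + b) / 3), ((a + b) / 2); split=> // x /andP[ux _].
  by rewrite horner_exp hornerXsubC exprn_gt0// subr_gt0; lra.
have tb : 0 < t * p.[b].
  have KE : s *: (- ('X - b%:P) ^+ d.+1) * ('X - a%:P) ^+ m * ('X - b%:P) ^+ m =
      (- s) *: ('X - a%:P) ^+ m * ('X - b%:P) ^+ (m + d.+1).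
    by rewrite exprD -!mul_polyC polyCN; ring.
  have sL : (size (- ('X - b%:P) ^+ d.+1)%R <= d.+2)%N.
    by rewrite size_polyN size_exp_XsubC.
  (* As [d.+1] is odd, the minus sign makes this factor nonnegative on the interval; it is also what
     reverses the sign at [b]. *)
  have LE x : (- ('X - b%:P) ^+ d.+1).[x] = (b - x) ^+ d.+1.
    rewrite hornerN horner_exp hornerXsubC -opprB exprNn -signr_odd /= d_even.
    by rewrite expr1 mulN1r opprK.
  have := apolar_neg sL.
  rewrite KE apolar_mulXsubC_exp// ?nm// Dmb hornerZ horner_exp hornerXsubC.
  set e := (b - a) ^+ m => h.
  have e2 : 0 < e ^+ 2 by rewrite exprn_gt0// exprn_gt0// subr_gt0.
  rewrite -oppr_lt0.
  rewrite -(pmulr_llt0 _ (mulr_gt0 (mulr_gt0 (fact_gt0 m) (fact_gt0 (m + d.+1)%N)) e2)).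
  rewrite [X in X < 0](_ : _ = (-1) ^+ (m + d.+1) * (m`!%:R * (p.[b] * e) *
    ((m + d.+1)`!%:R * (- s * e)))); last by rewrite /t; ring.
  apply: h => [x /andP[_ xb]|].
    by rewrite LE exprn_ge0// subr_ge0 ltW.
  exists ((a + a + b) / 3), ((a + b) / 2); split=> // x /andP[_ xv].
  by rewrite LE exprn_gt0// subr_gt0; lra.
have [|x /andP[ax xb] px] := @poly_ivt R (t *: p) a b (ltW ab).
  by rewrite !hornerZ !ltW.
have tx : t * p.[x] = 0 by move: px; rewrite /root hornerZ => /eqP.
exists x.
  rewrite !lt_neqAle ax xb !andbT; apply/andP; split; apply/eqP => E.
    by move: ta; rewrite E tx ltxx.
  by move: tb; rewrite -E tx ltxx.
have t0 : t != 0 by apply/eqP => t0; move: ta; rewrite t0 mul0r ltxx.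
move: tx => /eqP; rewrite mulf_eq0 (negPf t0) /= => /eqP px0.
by rewrite Dp !hornerE px0 !mul0r.
Qed.

Lemma crossing_unique x y : a < x < b -> a < y < b -> x < y ->
  D.[x] = 0 -> D.[y] = 0 -> False.
Proof.
move=> /andP[ax xb] /andP[ay yb] xy Dx Dy.
have ba : b != a by rewrite gt_eqF.
(* The polar derivatives at [a] use up the zeros at [b] and keep those at [a], which the polar
   derivatives at [b] then use up. *)
have [|||||E1 [sE1 E1a [x1 [y1 [xy1 x1ab y1ab E1x E1y]]] E1M]] :=
  @polar_iter R (m + d.+1) m a b m D.
- by rewrite eq_sym.
- by rewrite -nE.
- exact: vanish_a.
- exact: vanish_b.
- by exists x, y; split=> //; nra.
have [|||||E2 [sE2 _ [x2 [y2 [xy2 x2ab y2ab E2x E2y]]] E2M]] :=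
  @polar_iter R d.+1 m b a 0 E1 => //.
  by exists x1, y1; split=> //; nra.
have ax2 : a < x2 by nra.
have y2b : y2 < b by nra.
have [|z /andP[xz zy] Ez] := @polar_rolle R d.+1 a E2 x2 y2 xy2 _ E2x E2y.
  by rewrite ax2.
have az : a < z by lra.
have zb : z < b by lra.
(* The factor ['X - a%:P] is for the last polar derivative; the even power of ['X - z%:P] keeps the
   sign and isolates the value at [z]. *)
pose L := ('X - z%:P) ^+ d * ('X - a%:P).
have sM : (size (s *: ('X - z%:P) ^+ d) <= d.+1)%N.
  by apply: leq_trans (size_scale_leq _ _) _; rewrite size_exp_XsubC.
have sL : (size L <= d.+2)%N.
  by apply: leq_trans (size_polyMleq _ _) _; rewrite size_exp_XsubC size_XsubC addn2.
have sL' : (size (s *: L) <= d.+2)%N by apply: leq_trans (size_scale_leq _ _) sL.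
have : apolar n (poly_derivs D) (s *: L * ('X - a%:P) ^+ m * ('X - b%:P) ^+ m) b < 0.
  apply: apolar_neg => // [t /andP[at_ _]|].
    rewrite /L hornerM horner_exp !hornerXsubC mulr_ge0//; last by rewrite subr_ge0 ltW.
    by apply: exprn_even_ge0; rewrite (negPf d_even).
  exists ((z + b) / 2), ((z + b + b) / 3); split; [lra|lra|lra|move=> t /andP[ut _]].
  rewrite /L hornerM horner_exp !hornerXsubC mulr_gt0//; last by lra.
  by rewrite exprn_gt0//; lra.
have sLb : (size (s *: L * ('X - b%:P) ^+ m)%R <= (m + d.+1).+1)%N.
  apply: leq_trans (size_polyMleq _ _) _; rewrite size_exp_XsubC addnS /=.
  by rewrite addnC -addnS leq_add2l.
(* The kernel factors are removed in the order of the polar derivatives; the remaining pairing, in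
   degree [d], is evaluated at [z], where it is zero. *)
rewrite mulrAC nE; have [k ->] := E1M _ sLb; have [l ->] := E2M _ sL'.
rewrite (apolar_poly_const b a)// /L scalerAl apolar_polar.
rewrite (apolar_poly_const a z (size_polar _ _) sM)//.
rewrite -mul_polyC apolar_mulXsubC_exp// => [|j]; last by rewrite subnn.
rewrite subnn (Ez : (polar d.+1 a E2)^`(0).[z] = 0).
by rewrite mul0r !mulr0 oppr0 !mulr0 ltxx.
Qed.

End UniqueCrossing.

(** * Constant sign of the top derivative, and assembly of the theorem *)

Lemma nonvanishing_same_sign (R : realType) (g : R -> R) (a b : R) :
    (forall x, a < x < b -> {for x, continuous g}) ->
    (forall x, a < x < b -> g x != 0) ->
  forall u v, a < u < b -> a < v < b -> 0 < g u * g v.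
Proof.
move=> gcont g0 u v.
wlog uv : u v / u <= v => [hwlog uab vab|uab vab].
  by case/orP: (le_total u v) => ?; [|rewrite mulrC]; exact: hwlog.
have /andP[au ub] := uab; have /andP[av vb] := vab.
rewrite ltNge; apply/negP => guv.
have [||c] := @IVT R g u v 0 uv.
- apply: continuous_in_subspaceT => x; rewrite inE /= in_itv /= => /andP[ux xv].
  by apply: gcont; apply/andP; split; lra.
- have gu0 := g0 u uab; have gv0 := g0 v vab; rewrite ge_min le_max.
  have [gu|gu] := ltrP (g u) 0; have [gv|gv] := ltrP (g v) 0;
    rewrite ?(ltW gu) ?(ltW gv) ?gu ?gv ?orbT//=.
    have := lt_le_trans (_ : 0 < g u * g v) guv.
    by rewrite nmulr_lgt0// ltxx => /(_ gu).
  suff : 0 < g u * g v by rewrite ltNge guv.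
  by rewrite mulr_gt0// lt_neqAle eq_sym ?gu0 ?gv0.
rewrite in_itv /= => /andP[uc cv] gc.
by have /eqP := g0 c ltac:(apply/andP; split; lra); apply.
Qed.

Theorem theorem2 (R : realType) (m1 m2 n : nat) (a b : R) (f : R -> R)
    (P Q : {poly R})
  (hm : (m2 < m1)%N)
  (hpar : ~~ odd (m1 - m2)%N)
  (hn : n = (m1 + m2 + 1)%N)
  (ha : 0 < a) (hab : a < b)
  (hfa : forall k, (k <= m1)%N -> derivablen_within `[a, b] k f a)
  (hfb : forall k, (k <= m1)%N -> derivablen_within `[a, b] k f b)
  (hfC : continuously_derivable_on `]a, b[ (n + 2)%N f)
  (hf0 : forall x, a < x < b -> derive1n (n + 1)%N f x != 0)
  (hP : (size P <= n.+1)%N)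
  (hPa : forall j, (j <= m1)%N -> (P^`(j)).[a] = derive1n_within `[a, b] j f a)
  (hPb : forall j, (j <= m2)%N -> (P^`(j)).[b] = derive1n_within `[a, b] j f b)
  (hQ : (size Q <= n.+1)%N)
  (hQa : forall j, (j <= m2)%N -> (Q^`(j)).[a] = derive1n_within `[a, b] j f a)
  (hQb : forall j, (j <= m1)%N -> (Q^`(j)).[b] = derive1n_within `[a, b] j f b) :
  exists! x0 : R, a < x0 < b /\ P.[x0] = Q.[x0].
Proof.
(* In the notation of the crossing lemmas, [m] is [m2.+1] and [d] is [e]. *)
have [e m1E d_even] : exists2 d, m1 = (m2.+1 + d.+1)%N & ~~ odd d.
  by exists (m1 - m2.+2)%N; lia.
have nE : n = (m2.+1 + (m2.+1 + e.+1))%N by rewrite hn m1E; lia.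
have df x : a < x < b -> forall j, (j < n + 2)%N -> derivable (derive1n j f) x 1.
  by move=> xab; have [] := hfC x; rewrite /= ?in_itv.
have df1 x : a < x < b ->
    forall j, (j < (m2.+1 + e).+1)%N -> derivable (derive1n j f) x 1.
  by move=> xab j jm; apply: df => //; lia.
(* Here [(m2.+1 + e).+1] is [m1], which equals [n - m2.+1], the highest order in the boundary
   terms. *)
have [|||a_ [a_ab a_a fa]] := @endpoint_sequence R f a b a (m2.+1 + e) hab.
- by left.
- exact: df1.
- by move=> k km; apply: hfa; lia.
have [|||b_ [b_ab b_b fb]] := @endpoint_sequence R f a b b (m2.+1 + e) hab.
- by right.
- exact: df1.
- by move=> k km; apply: hfb; lia.
pose F i x := derive1n i f x - (P^`(i)).[x].
have dF x : a < x < b -> forall i, (i <= n)%N -> is_derive x 1 (F i) (F i.+1 x).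
  move=> xab i ni.
  have fi : is_derive x 1 (derive1n i f) (derive1n i.+1 f x).
    by rewrite derive1nS derive1E; apply: derivableP; apply: df => //; lia.
  have Pi : is_derive x 1 (horner P^`(i)) (P^`(i.+1)).[x].
    by rewrite derivnS; exact: is_derive_poly.
  exact: is_deriveB fi Pi.
have FnE x : F n.+1 x = derive1n (n + 1) f x.
  by rewrite /F derivn_poly0// horner0 subr0 addn1.
pose D := P - Q.
have Fa i : (i <= n - m2.+1)%N -> F i (a_ k) @[k --> \oo] --> 0.
  move=> im; have im1 : (i <= m1)%N by lia.
  rewrite -(subrr (derive1n_within `[a, b] i f a)) -{2}(hPa i im1).
  apply: cvgB; first by apply: fa; lia.
  by apply: cvg_comp a_a _; exact: continuous_horner.
(* At [b] it is [Q] that matches [f] up to order [m1], so [f - P] behaves like [Q - P]. *)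
have Fb i : (i <= n - m2.+1)%N -> F i (b_ k) @[k --> \oo] --> - D^`(i).[b].
  move=> im; have im1 : (i <= m1)%N by lia.
  rewrite /D derivnB hornerD hornerN opprB (hQb i im1).
  apply: cvgB; first by apply: fb; lia.
  by apply: cvg_comp b_b _; exact: continuous_horner.
pose c := (a + b) / 2; pose s := derive1n (n + 1) f c.
have cab : a < c < b by rewrite /c; apply/andP; split; lra.
have fs x : a < x < b -> 0 < derive1n (n + 1) f x * s.
  move=> xab; apply: (@nonvanishing_same_sign _ (derive1n (n + 1) f) a b) => //.
  move=> t tab; apply: differentiable_continuous; apply/derivable1_diffP.
  by apply: df => //; lia.
(* The factor [s] carries the constant sign of the top derivative, and [(-1) ^+ m2.+1] cancels the
   sign in [apolar_lt0]. *)
have apolar_neg (L : {poly R}) : (size L <= e.+2)%N ->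
    (forall x, a < x < b -> 0 <= L.[x]) ->
    (exists u v, [/\ a < u, u < v, v < b & forall x, u < x < v -> 0 < L.[x]]) ->
  apolar n (poly_derivs D) ((s * (-1) ^+ m2.+1) *: L * ('X - a%:P) ^+ m2.+1 *
    ('X - b%:P) ^+ m2.+1) b < 0.
  move=> sL L0 [u [v [au uv vb Luv]]].
  have LE x : F n.+1 x * ((-1) ^+ m2.+1 * ((s * (-1) ^+ m2.+1) *: L).[x]) =
      derive1n (n + 1) f x * s * L.[x].
    rewrite FnE hornerZ.
    have E : (-1) ^+ m2.+1 * (-1) ^+ m2.+1 = 1 :> R.
      by rewrite -exprMn mulN1r opprK expr1n.
    by rewrite -[RHS]mulr1 -[X in _ = _ * X]E; ring.
  apply: (apolar_lt0 (F := F) (a_ := a_) (b_ := b_) (u := u) (v := v)) => //.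
  - by lia.
  - by apply: leq_trans (size_scale_leq _ _) _; apply: leq_trans sL _; lia.
  - by move=> x xab; rewrite LE mulr_ge0 ?L0// ltW ?fs.
  - move=> x xuv; rewrite LE mulr_gt0 ?Luv// fs//.
    by move/andP: xuv => [ux xv]; apply/andP; split; lra.
have size_D : (size D <= n.+1)%N.
  by apply: leq_trans (size_polyD _ _) _; rewrite geq_max hP size_polyN.
have Da j : (j < m2.+1)%N -> D^`(j).[a] = 0.
  by move=> jm; rewrite /D derivnB hornerD hornerN hPa ?hQa ?subrr//; lia.
have Db j : (j < m2.+1)%N -> D^`(j).[b] = 0.
  by move=> jm; rewrite /D derivnB hornerD hornerN hPb ?hQb ?subrr//; lia.
have PQ x : P.[x] = Q.[x] <-> D.[x] = 0.
  by rewrite /D hornerD hornerN; split=> [->|/eqP]; rewrite ?subrr// subr_eq0 => /eqP.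
have [x xab Dx] := crossing_exists d_even hab nE size_D Da Db apolar_neg.
exists x; split; first by split=> //; apply/PQ.
move=> y [yab /PQ Dy].
have no_two := crossing_unique d_even hab nE size_D Da Db apolar_neg.
have [xy|yx|//] := ltgtP x y.
  by case: (no_two x y).
by case: (no_two y x).
Qed.
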